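(* For all $\epsilon\in(0,1/2)$, $\delta\in(0,1)$, all $c,d\in\mathbb{N}^+$ with $c>1$, and all $\gamma>0$, $$G^d_{\mathcal{U}^c\to\mathcal{C}}(\epsilon,\delta,n)\in\Omega(n^{1-\gamma})\quad\text{as } n\to\infty.$$
   Context: Let $\mathcal{B}=\{0,1\}$, let $\mathcal{B}^*$ be the set of finite binary strings and $|h|$ the length of $h\in\mathcal{B}^*$. For $n\in\mathbb{N}^+$, $H^n$ is the set of all functions $\mathcal{B}^n\to\mathcal{B}$ and $\Delta(\mathcal{B}^n)$ the set of probability distributions on $\mathcal{B}^n$. A learning problem is a pair $(f,\mathcal{P})$ with $f\in H^n$, $\mathcal{P}\in\Delta(\mathcal{B}^n)$; an $m$-sample dataset for it is the random sequence $[(x_j,f(x_j))]_{j=1}^m$ with $x_1,\dots,x_m$ i.i.d. $\sim\mathcal{P}$. The accuracy of $\hat f\in H^n$ is $\mathrm{acc}^{\mathcal{P}}_f(\hat f)=\Pr_{x\sim\mathcal{P}}[\hat f(x)=f(x)]$. For $\epsilon\in(0,1/2)$, $\delta\in(0,1)$, an algorithm $\mathcal{A}$ has an $(\epsilon,\delta)$-PAC-learning performance with an $m$-sample dataset on $(f,\mathcal{P})$ if for every $m'\ge m$, with probability at least $1-\delta$ over an $m'$-sample dataset $S$, $\mathrm{acc}^{\mathcal{P}}_f(\mathcal{A}(S))\ge 1-\epsilon$. An interpreter is a Turing machine computing a partial function $\varphi:\mathcal{B}^*\times\mathcal{B}^*\to\mathcal{B}\cup\{\bot\}$, where $\bot$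 denotes non-halting (or invalid) output. For $f\in H^n$, $|f|_\varphi=\min\{|h|:\varphi(h,x)=f(x)\ \forall x\in\mathcal{B}^n\}$ ($+\infty$ if no such $h$). The learning algorithm $\mathit{MDL}^\varphi$, on a dataset $[(x_j,y_j)]_{j=1}^m$ with $x_j\in\mathcal{B}^n$, selects $h^*$ of minimal length among all $h$ with $\varphi(h,x_j)=y_j$ for all $j$ and $\varphi(h,x)\neq\bot$ for all $x\in\mathcal{B}^n$ (ties broken arbitrarily) and outputs $x\mapsto\varphi(h^*,x)$ on $\mathcal{B}^n$. $m^{\epsilon,\delta}_\varphi(f,\mathcal{P})$ is the least $m\in\mathbb{N}^+$ such that $\mathit{MDL}^\varphi$ has an $(\epsilon,\delta)$-PAC-learning performance with an $m$-sample dataset on $(f,\mathcal{P})$ ($+\infty$ if none). For interpreters $\varphi,\psi$ and $n,d\in\mathbb{N}^+$, the sample efficiency gain is $G^d_{\varphi\to\psi}(\epsilon,\delta,n)=\sup\{ m^{\epsilon,\delta}_\psi(f,\mathcal{P})/m^{\epsilon,\delta}_\varphi(f,\mathcal{P}) : f\in H^n,\ \mathcal{P}\in\Delta(\mathcal{B}^n),\ |f|_\varphi\le n^d\}$. Turing machines have alphabet $\{0,1,b\}$ ($b$ blank), a finite state set containing an initial state and two final states accept/reject; the output is $1$ if halting in accept, $0$ if halting in reject, $\bot$ otherwise; multi-tape machines have read-only input tapes and read/write work tapes, and the transition function is a finite list of rules. $E(T)$ is a fixed prefix-free binary encoding of a machine $T$ listing its rules (of length at least 2 for every machine). For $c\in\mathbb{N}^+$,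 $\mathcal{U}^c$ is a time-bounded universal interpreter (a 2-input-tape, 3-work-tape machine): on $(p,x)$ with $n=|x|$, it checks within $n^c$ steps whether $p=E(T)u$ for a two-input-tape machine $T$ and $u\in\mathcal{B}^*$ (outputting $\bot$ if not, or if the check does not finish), then simulates $T$ on $(u,x)$ with an efficient universal simulation (Hennie–Stearns, overhead $O(t\log t)$ for $t$ simulated steps), devoting at most $n^c$ of its own steps to the simulation; it outputs $T$'s output if $T$ halts within this budget and $0$ otherwise. For fixed $p$ it runs in at most $\beta n^c$ steps for a constant $\beta$. In particular, if a Turing machine computes $g:\mathcal{B}^*\to\mathcal{B}$ in time $O(n^{c'})$ with $c'<c$, there is $h\in\mathcal{B}^*$ with $\mathcal{U}^c(h,x)=g(x)$ for all $x$ of sufficiently large length. A Boolean circuit on $n$ inputs is a DAG with a unique sink (output) whose sources are labelled by input indices in $\{1,\dots,n\}$ and whose other vertices (gates) are labelled AND, OR (two incoming edges) or NOT (one incoming edge); its size $|C|$ is its number of vertices. The circuit interpreter $\mathcal{C}$ reads a program $h=0^{\lceil\log_2 n\rceil}1\,[\text{binary expansion of } n]\,0^{|C|}1\,[\text{description of vertex } i]_{i=1}^{|C|}$, each vertex being described by its label and its parents/input index using $\max\{2\lceil\log_2|C|\rceil,\lceil\log_2 n\rceil\}$ bits beyond the label bits, so a circuit $C$ on $n$ inputs has encoding length $L(|C|,n)=2\lceil\log_2 n\rceil+2+|C|(3+\max\{2\lceil\log_2|C|\rceil,\lceil\log_2 n\rceil\})$; $\mathcal{C}(h,x)$ is the circuit's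 output on $x\in\mathcal{B}^n$, and $\bot$ if $h$ is malformed. Hence $|f|_{\mathcal{C}}=\min\{L(|C|,n): C \text{ computes } f\}$. *)

(* Defs.v *)
From HB Require Import structures.
From Stdlib Require Import Reals ClassicalEpsilon.
From mathcomp Require Import all_boot all_order all_algebra.
From mathcomp Require Import Rstruct.
From mathcomp Require Import classical_sets ereal.

Set Implicit Arguments.
Unset Strict Implicit.
Unset Printing Implicit Defensive.

Import Order.TTheory GRing.Theory Num.Theory.

(** A program / input is a finite binary string [seq bool].
    An interpreter is a partial function B* x B* -> B u {bot};
    [None] stands for bot (non-halting or invalid output). *)
Definition interpreter := seq bool -> seq bool -> option bool.

(** Symbols: [Some false] = 0, [Some true] = 1, [None] = blank b. *)
Definition sym := option bool.

Inductive mv := ML | MR | MS.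

(** A rule: in state [r_state], reading [r_read] on the (input tapes ++ work
    tapes), go to state [r_next], write [r_write] on the work tapes and move
    the heads of all tapes according to [r_move]. *)
Record rule := Rule {
  r_state : nat; r_read : seq sym; r_next : nat;
  r_write : seq sym; r_move : seq mv }.

(** A machine with [k] read-only input tapes: a number of read/write work
    tapes and a finite list of rules (the transition function).  States are
    natural numbers; by convention 0 is the initial state, 1 = accept and
    2 = reject (the two final states); the state set is finite since it is
    the finite set of states mentioned by the rules. *)
Record TM (k : nat) := MkTM { tm_work : nat; tm_rules : seq rule }.

Definition q_init := 0%N.
Definition q_acc := 1%N.
Definition q_rej := 2%N.

(** A tape as a zipper (reversed left part, scanned cell, right part),
    with blanks beyond both ends. *)
Definition tape := (seq sym * sym * seq sym)%type.

Definition tread (t : tape) : sym := t.1.2.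
Definition twrite (a : sym) (t : tape) : tape := (t.1.1, a, t.2).
Definition tmove (m : mv) (t : tape) : tape :=
  let: (l, a, r) := t in
  match m with
  | ML => match l with [::] => ([::], None, a :: r) | b :: l' => (l', b, a :: r) end
  | MR => match r with [::] => (a :: l, None, [::]) | b :: r' => (a :: l, b, r') end
  | MS => t
  end.

Definition init_tape (w : seq bool) : tape :=
  match w with [::] => ([::], None, [::]) | b :: w' => ([::], Some b, map Some w') end.
Definition blank_tape : tape := ([::], None, [::]).

(** Configuration: state, input tapes, work tapes. *)
Definition config := (nat * seq tape * seq tape)%type.

Definition applicable (q : nat) (ins ws : seq tape) (r : rule) : bool :=
  [&& r_state r == q, r_read r == map tread (ins ++ ws),
      size (r_write r) == size ws & size (r_move r) == size (ins ++ ws)].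

Definition apply_rule (ins ws : seq tape) (r : rule) : config :=
  let mvs_in := take (size ins) (r_move r) in
  let mvs_w := drop (size ins) (r_move r) in
  (r_next r,
   [seq tmove m.1 m.2 | m <- zip mvs_in ins],
   [seq tmove m.1 (twrite m.2.1 m.2.2) | m <- zip mvs_w (zip (r_write r) ws)]).

(** One deterministic step: final states are absorbing; otherwise the first
    applicable rule is used; if none applies, the machine is stuck (halts in
    a non-final state, i.e. its output is bot). *)
Definition step k (M : TM k) (c : config) : config :=
  let: (q, ins, ws) := c in
  if (q == q_acc) || (q == q_rej) then c else
  match [seq r <- tm_rules M | applicable q ins ws r] with
  | r :: _ => apply_rule ins ws r
  | [::] => c
  end.

Definition tm_init k (M : TM k) (inputs : seq (seq bool)) : config :=
  (q_init, map init_tape inputs, nseq (tm_work M) blank_tape).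

Definition tm_out_within k (M : TM k) (inputs : seq (seq bool)) (t : nat) : option bool :=
  let q := (iter t (step M) (tm_init M inputs)).1.1 in
  if q == q_acc then Some true else if q == q_rej then Some false else None.

Definition tm_outputs k (M : TM k) (inputs : seq (seq bool)) (b : bool) : Prop :=
  exists t, tm_out_within M inputs t = Some b.

Definition computes_in_time (M : TM 1) (g : seq bool -> bool) (c' : R) : Prop :=
  (forall x, tm_outputs M [:: x] (g x)) /\
  exists (K : R) (N0 : nat), forall x, (N0 <= size x)%N ->
    exists t : nat, (INR t <= K * Rpower (INR (size x)) c')%R /\
                    tm_out_within M [:: x] t = Some (g x).

(** [time_bounded_universal c U]: [U] behaves as the paper's U^c, for some
    fixed prefix-free encoding [E] of two-input-tape machines (every code of
    length >= 2):
    - [U p x] is bot unless [p = E(T) ++ u]; in that case [U p x] is bot (the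
      check did not finish), or 0 (the simulation budget was exhausted), or
      the output of [T] on [(u, x)] (T halted within the budget);
    - (the property stated in the paper) if a Turing machine computes
      [g : B* -> B] in time O(n^c') with c' < c, then some program [h]
      satisfies [U h x = g x] for all [x] of sufficiently large length. *)
Definition time_bounded_universal (c : nat) (U : interpreter) : Prop :=
  exists E : TM 2 -> seq bool,
    (forall T T', prefix (E T) (E T') -> T = T') /\
    (forall T, (2 <= size (E T))%N) /\
    (forall p x, U p x <> None ->
       exists (T : TM 2) (u : seq bool), p = E T ++ u /\
         (U p x = Some false \/
          exists b, U p x = Some b /\ tm_outputs T [:: u; x] b)) /\
    (forall (c' : R) (g : seq bool -> bool) (M : TM 1),
       (c' < INR c)%R -> computes_in_time M g c' ->
       exists (h : seq bool) (N : nat), forall x, (N <= size x)%N -> U h x = Some (g x)).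

(** A vertex of a circuit.  Vertices are numbered 0 .. |C|-1 (vertex i of
    the paper is number i-1), inputs 0 .. n-1 (input index i of the paper is
    number i-1).  [GIn i] is a source labelled by input i; the gates list
    their parents. *)
Inductive gate := GIn of nat | GAnd of nat & nat | GOr of nat & nat | GNot of nat.

Definition circuit := seq gate.

Definition parents (g : gate) : seq nat :=
  match g with GIn _ => [::] | GAnd a b => [:: a; b] | GOr a b => [:: a; b] | GNot a => [:: a] end.

Definition cedge (C : circuit) : rel nat :=
  fun u v => (v < size C)%N && (u \in parents (nth (GIn 0) C v)).

Definition sinks (C : circuit) : seq nat :=
  [seq v <- iota 0 (size C) | ~~ has (fun w => cedge C v w) (iota 0 (size C))].

Definition circuit_wf (n : nat) (C : circuit) : Prop :=
  [/\ (0 < size C)%N,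
      all (fun g => match g with GIn i => (i < n)%N | _ => true end) C,
      all (fun g => all (fun u => (u < size C)%N) (parents g)) C,
      (forall (v : nat) (p : seq nat), path (cedge C) v p -> last v p = v -> p = [::])
    & size (sinks C) = 1%N].

Fixpoint veval (C : circuit) (x : seq bool) (fuel v : nat) : option bool :=
  match fuel with
  | 0 => None
  | fuel'.+1 =>
    match nth (GIn 0) C v with
    | GIn i => Some (nth false x i)
    | GAnd a b => obind (fun va => omap (andb va) (veval C x fuel' b)) (veval C x fuel' a)
    | GOr a b => obind (fun va => omap (orb va) (veval C x fuel' b)) (veval C x fuel' a)
    | GNot a => omap negb (veval C x fuel' a)
    end
  end.

(** Value computed by the circuit (the value of its unique sink); for an
    acyclic circuit, fuel |C| suffices. *)
Definition ceval (C : circuit) (x : seq bool) : bool :=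
  odflt false (veval C x (size C) (head 0 (sinks C))).

Definition clog2 (n : nat) : nat := up_log 2 n.

Definition bits (k v : nat) : seq bool := [seq odd (v %/ 2 ^ (k - i.+1)) | i <- iota 0 k].

(** Encoding of a circuit on n inputs, following the paper's layout:
    0^{ceil log2 n} 1 [n] 0^{|C|} 1 [vertex 1] ... [vertex |C|],
    where [n] is written on ceil(log2 n) bits (we store n-1), and
    every vertex uses 2 label bits (00 input, 01 AND, 10 OR, 11 NOT) followed
    by B = max(2 ceil(log2 |C|), ceil(log2 n)) bits: the input index on
    ceil(log2 n) bits, or the parent(s) on ceil(log2 |C|) bits each, padded
    with zeros. *)
Definition circ_encode (n : nat) (C : circuit) : seq bool :=
  let a := clog2 n in
  let s := size C in
  let lp := clog2 s in
  let B := maxn (2 * lp) a in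
  let vdesc (g : gate) :=
    match g with
    | GIn i => [:: false; false] ++ bits a i ++ nseq (B - a) false
    | GAnd p q => [:: false; true] ++ bits lp p ++ bits lp q ++ nseq (B - 2 * lp) false
    | GOr p q => [:: true; false] ++ bits lp p ++ bits lp q ++ nseq (B - 2 * lp) false
    | GNot p => [:: true; true] ++ bits lp p ++ nseq (B - lp) false
    end in
  nseq a false ++ true :: bits a n.-1 ++ nseq s false ++ true :: flatten (map vdesc C).

(** L(|C|, n) of the paper (equal to [size (circ_encode n C)] for wf C). *)
Definition circ_len (s n : nat) : nat :=
  2 * clog2 n + 2 + s * (3 + maxn (2 * clog2 s) (clog2 n)).

Definition circ_spec (h x : seq bool) (o : option bool) : Prop :=
  (exists C, circuit_wf (size x) C /\ circ_encode (size x) C = h /\ o = Some (ceval C x)) \/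
  (~ (exists C, circuit_wf (size x) C /\ circ_encode (size x) C = h) /\ o = None).

Definition circ_interp : interpreter :=
  fun h x => epsilon (inhabits None) (circ_spec h x).

Local Open Scope ring_scope.

Definition is_distr (n : nat) (P : n.-tuple bool -> R) : Prop :=
  (forall x, 0 <= P x) /\ \sum_(x : n.-tuple bool) P x = 1.

Definition prog_computes (phi : interpreter) (n : nat) (h : seq bool)
    (f : n.-tuple bool -> bool) : Prop :=
  forall x : n.-tuple bool, phi h x = Some (f x).

Definition desc_len_le (phi : interpreter) (n : nat) (f : n.-tuple bool -> bool)
    (k : nat) : Prop :=
  exists h, (size h <= k)%N /\ prog_computes phi h f.

Definition dataset (n : nat) := seq (n.-tuple bool * bool).

Definition mdl_candidate (phi : interpreter) (n : nat) (D : dataset n) (h : seq bool) : Prop :=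
  (forall p, p \in D -> phi h p.1 = Some p.2) /\ (forall x : n.-tuple bool, phi h x <> None).

(** A tie-breaking rule for MDL^phi: it returns a candidate of minimal length
    (whenever a candidate exists). *)
Definition selector := forall n : nat, dataset n -> seq bool.

Definition mdl_selector (phi : interpreter) (sel : selector) : Prop :=
  forall n (D : dataset n), (exists h, mdl_candidate phi D h) ->
    mdl_candidate phi D (sel n D) /\
    (forall h, mdl_candidate phi D h -> (size (sel n D) <= size h)%N).

Definition accuracy (n : nat) (P : n.-tuple bool -> R) (f : n.-tuple bool -> bool)
    (hyp : n.-tuple bool -> option bool) : R :=
  \sum_(x : n.-tuple bool | hyp x == Some (f x)) P x.

Definition prob_sample (n m : nat) (P : n.-tuple bool -> R)
    (E : m.-tuple (n.-tuple bool) -> bool) : R :=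
  \sum_(xs : m.-tuple (n.-tuple bool)) (\prod_(j < m) P (tnth xs j)) * (E xs)%:R.

Definition labelled (n m : nat) (f : n.-tuple bool -> bool) (xs : m.-tuple (n.-tuple bool))
    : dataset n := [seq (x, f x) | x <- xs].

Definition mdl_pac (phi : interpreter) (sel : selector) (eps delta : R) (n : nat)
    (f : n.-tuple bool -> bool) (P : n.-tuple bool -> R) (m : nat) : Prop :=
  forall m' : nat, (m <= m')%N ->
    1 - delta <= prob_sample P
      (fun xs : m'.-tuple (n.-tuple bool) =>
         1 - eps <= accuracy P f (fun x => phi (sel n (labelled f xs)) x)).

(** [o] is m^{eps,delta}_phi(f,P): [Some m] = least m >= 1 with the PAC
    performance; [None] = +infinity. *)
Definition is_sample_complexity (phi : interpreter) (sel : selector) (eps delta : R)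
    (n : nat) (f : n.-tuple bool -> bool) (P : n.-tuple bool -> R) (o : option nat) : Prop :=
  match o with
  | Some m => [/\ (0 < m)%N, mdl_pac phi sel eps delta f P m &
                  forall m', (0 < m')%N -> mdl_pac phi sel eps delta f P m' -> (m <= m')%N]
  | None => forall m, (0 < m)%N -> ~ mdl_pac phi sel eps delta f P m
  end.

Definition sample_complexity (phi : interpreter) (sel : selector) (eps delta : R)
    (n : nat) (f : n.-tuple bool -> bool) (P : n.-tuple bool -> R) : option nat :=
  epsilon (inhabits None) (is_sample_complexity phi sel eps delta f P).

Definition sc_ratio (m_psi m_phi : option nat) : \bar R :=
  match m_phi, m_psi with
  | Some a, Some b => ((b%:R / a%:R : R)%:E)
  | Some _, None => +oo%E
  | None, _ => 0%E
  end.

Local Open Scope classical_set_scope.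

Definition gain (phi : interpreter) (selphi : selector) (psi : interpreter)
    (selpsi : selector) (d : nat) (eps delta : R) (n : nat) : \bar R :=
  ereal_sup [set r : \bar R | exists (f : n.-tuple bool -> bool) (P : n.-tuple bool -> R),
      [/\ is_distr P, desc_len_le phi f (n ^ d) &
          r = sc_ratio (sample_complexity psi selpsi eps delta f P)
                       (sample_complexity phi selphi eps delta f P)]].

(* Main.v *)
(* The gain is witnessed by one fixed function, the OR of all input bits, under
   the distribution putting mass 1/2 on the zero vector and 1/(2n) on each unit
   vector.  A one-state machine computes OR in linear time, so OR has a program
   of constant length for U, and a union bound over the finitely many programs
   that are not longer bounds the sample complexity of U by a constant.  For
   circuits, the OR of one well-chosen input per sample fits m samples with
   2m+1 vertices, so MDL outputs a circuit reading at most 2m+1 inputs.  Such a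
   circuit does not distinguish the zero vector from the unit vectors of the
   unread coordinates, hence errs with probability at least
   min(1/2, (n-2m-2)/(2n)), whatever the sample.  So m is at least linear in n. *)

Require Import Defs.
From Stdlib Require Import Reals ClassicalEpsilon.
From mathcomp Require Import all_boot all_order all_algebra.
From mathcomp Require Import Rstruct ring lra zify.
From mathcomp Require Import classical_sets ereal.

Import Order.TTheory GRing.Theory Num.Theory.
Local Open Scope ring_scope.

(** * OR in linear time on a Turing machine *)

Definition or_tm : TM 1 := @MkTM 1 0
  [:: Rule 0 [:: Some false] 0 [::] [:: MR];
      Rule 0 [:: Some true] 1 [::] [:: MS];
      Rule 0 [:: None] 2 [::] [:: MS]].

Definition tape_at (l : seq sym) (w : seq bool) : tape :=
  match w with
  | [::] => (l, None, [::])
  | b :: w' => (l, Some b, map Some w')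
  end.

Lemma iter_step_final k (M : TM k) t q ins ws :
  (q == q_acc) || (q == q_rej) -> iter t (step M) (q, ins, ws) = (q, ins, ws).
Proof. by move=> qf; elim: t => //= t ->; rewrite /= qf. Qed.

(** The left part [l] is arbitrary because it grows as the head moves right. One step per symbol and
    a last one on the blank suffice; after an earlier 1 the accepting state is absorbing. *)
Lemma iter_or_tm w l :
  (iter (size w).+1 (step or_tm) (0%N, [:: tape_at l w], [::])).1.1 =
  if has id w then q_acc else q_rej.
Proof.
elim: w l => [|b w IHw] l; first by [].
rewrite iterSr; case: b.
  have -> : step or_tm (0%N, [:: tape_at l (true :: w)], [::]) =
            (1%N, [:: tape_at l (true :: w)], [::]) by [].
  by rewrite iter_step_final.
have -> : step or_tm (0%N, [:: tape_at l (false :: w)], [::]) =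
          (0%N, [:: tape_at (Some false :: l) w], [::]) by case: w {IHw}.
exact: IHw.
Qed.

Lemma or_tm_out x : tm_out_within or_tm [:: x] (size x).+1 = Some (has id x).
Proof.
have -> : tm_out_within or_tm [:: x] (size x).+1 =
    let q := (iter (size x).+1 (step or_tm) (0%N, [:: tape_at [::] x], [::])).1.1 in
    if q == q_acc then Some true else if q == q_rej then Some false else None.
  by case: x.
by rewrite iter_or_tm; case: ifP.
Qed.

Lemma or_tm_linear_time : computes_in_time or_tm (has id) 1.
Proof.
split=> [x|]; first by exists (size x).+1; exact: or_tm_out.
exists 2, 1%N => x x0; exists (size x).+1; split; last exact: or_tm_out.
rewrite Rpower_1; first by rewrite !INRE -natrM ler_nat; lia.
by apply/RltP; rewrite INRE ltr0n.
Qed.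

(** * Dependence of a circuit on the inputs it reads *)

(* Input 0 is included because out-of-range vertices evaluate as [GIn 0]. *)
Definition circuit_reads (C : circuit) : seq nat :=
  0%N :: [seq if g is GIn i then i else 0%N | g <- C].

Lemma veval_reads C x y fuel v :
  {in circuit_reads C, nth false x =1 nth false y} ->
  veval C x fuel v = veval C y fuel v.
Proof.
move=> xy; elim: fuel v => //= fuel IH v.
case Ev: (nth (GIn 0) C v) => [i|a b|a b|a]; rewrite ?IH //.
congr Some; apply: xy; rewrite inE.
have [vC|Cv] := ltnP v (size C); last by move: Ev; rewrite nth_default // => -[<-].
apply/orP; right.
have := mem_nth 0%N (s := [seq if g is GIn i then i else 0%N | g <- C]) (n := v).
by rewrite size_map (nth_map (GIn 0)) // Ev; apply.
Qed.

Lemma ceval_reads C x y :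
  {in circuit_reads C, nth false x =1 nth false y} -> ceval C x = ceval C y.
Proof. by move=> xy; rewrite /ceval (@veval_reads C x y). Qed.

(** * Length and injectivity of the circuit encoding *)

(* The local function [vdesc] of [circ_encode]. *)
Definition gate_code (a lp B : nat) (g : gate) : seq bool :=
  match g with
  | GIn i => [:: false; false] ++ bits a i ++ nseq (B - a) false
  | GAnd p q => [:: false; true] ++ bits lp p ++ bits lp q ++ nseq (B - 2 * lp) false
  | GOr p q => [:: true; false] ++ bits lp p ++ bits lp q ++ nseq (B - 2 * lp) false
  | GNot p => [:: true; true] ++ bits lp p ++ nseq (B - lp) false
  end.

Definition gate_bounded (n s : nat) (g : gate) : bool :=
  match g with
  | GIn i => (i < n)%N
  | GAnd p q | GOr p q => (p < s)%N && (q < s)%N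
  | GNot p => (p < s)%N
  end.

Lemma circ_encodeE n C :
  circ_encode n C =
    nseq (clog2 n) false ++ true :: bits (clog2 n) n.-1 ++ nseq (size C) false ++
    true :: flatten [seq gate_code (clog2 n) (clog2 (size C))
                      (maxn (2 * clog2 (size C)) (clog2 n)) g | g <- C].
Proof. by []. Qed.

Lemma size_bits k v : size (bits k v) = k.
Proof. by rewrite size_map size_iota. Qed.

Lemma odd_digits_inj k v w :
  (forall i, i < k -> odd (v %/ 2 ^ i) = odd (w %/ 2 ^ i))%N ->
  (v < 2 ^ k)%N -> (w < 2 ^ k)%N -> v = w.
Proof.
elim: k v w => [|k IHk] v w vw; first by rewrite expn0; lia.
rewrite expnS => vk wk.
have := vw 0%N erefl; rewrite expn0 !divn1 => odd_vw.
have half_vw : (v %/ 2 = w %/ 2)%N.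
  by apply: IHk; [move=> i ik; rewrite -!divnMA -expnS vw|lia|lia].
by rewrite (divn_eq v 2) (divn_eq w 2) half_vw !modn2 odd_vw.
Qed.

Lemma bits_inj k v w :
  (v < 2 ^ k)%N -> (w < 2 ^ k)%N -> bits k v = bits k w -> v = w.
Proof.
move=> vk wk bvw; apply: (@odd_digits_inj k) => // i ik.
(* [bits] puts the most significant digit first, so digit [i] sits at position [k - i.+1]. *)
have kik : (k - i.+1 < k)%N by lia.
move/(congr1 (nth false ^~ (k - i.+1)%N)): bvw.
rewrite !(nth_map 0%N) ?size_iota // nth_iota //.
by have -> : (k - (0 + (k - i.+1)).+1 = i)%N by lia.
Qed.

Lemma size_gate_code a lp B g :
  (a <= B)%N -> (2 * lp <= B)%N -> size (gate_code a lp B g) = B.+2.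
Proof.
by move=> aB lB; case: g => *; rewrite /= ?size_cat ?size_bits ?size_nseq; lia.
Qed.

Lemma gate_code_inj a lp B n s g g' :
  (n <= 2 ^ a)%N -> (s <= 2 ^ lp)%N ->
  gate_bounded n s g -> gate_bounded n s g' ->
  gate_code a lp B g = gate_code a lp B g' -> g = g'.
Proof.
move=> na sl.
have bI k N v w x y : (N <= 2 ^ k)%N -> (v < N)%N -> (w < N)%N ->
    bits k v ++ x = bits k w ++ y -> v = w /\ x = y.
  move=> Nk vN wN /eqP; rewrite eqseq_cat ?size_bits // => /andP[/eqP bE /eqP ->].
  by split=> //; apply: (bits_inj _ _ _ _ _ bE); exact: leq_trans Nk.
case: g => [i|p q|p q|p]; case: g' => [i'|p' q'|p' q'|p'] //=.
- by move=> iN i'N [/(bI _ _ _ _ _ _ na iN i'N)[-> _]].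
- move=> /andP[ps qs] /andP[p's q's] [/(bI _ _ _ _ _ _ sl ps p's)[->]].
  by move=> /(bI _ _ _ _ _ _ sl qs q's)[->].
- move=> /andP[ps qs] /andP[p's q's] [/(bI _ _ _ _ _ _ sl ps p's)[->]].
  by move=> /(bI _ _ _ _ _ _ sl qs q's)[->].
- by move=> ps p's [/(bI _ _ _ _ _ _ sl ps p's)[-> _]].
Qed.

(** Blocks of equal width [w] can be cut off one at a time. *)
Lemma flatten_map_inj (T S : Type) (f : T -> seq S) (w : nat) (p : pred T) (s t : seq T) :
  (forall x, size (f x) = w) -> (forall x y, p x -> p y -> f x = f y -> x = y) ->
  all p s -> all p t -> size s = size t ->
  flatten (map f s) = flatten (map f t) -> s = t.
Proof.
move=> fw fI; elim: s t => [|x s IHs] [|y t] //= /andP[px ps] /andP[py pt] [st] E.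
have := congr1 (take w) E; have := congr1 (drop w) E.
rewrite !take_size_cat ?drop_size_cat ?fw // => Est Exy.
by rewrite (fI x y) // (IHs t).
Qed.

Lemma circuit_wf_bounded n C : circuit_wf n C -> all (gate_bounded n (size C)) C.
Proof.
case=> _ inC parC _ _; have := conj inC parC.
move=> /andP; rewrite -all_predI; apply: sub_all => -[i|p q|p q|p] /=; rewrite ?andbT //.
Qed.

(** Strictness serves twice: the code length determines the number of vertices, and a code no longer
    than another has no more vertices. *)
Lemma circ_len_ltn n s s' : (s < s')%N -> (circ_len s n < circ_len s' n)%N.
Proof.
move=> ss'; have := leq_up_log 2 (ltnW ss'); rewrite /circ_len /clog2; nia.
Qed.

Lemma size_circ_encode n C : size (circ_encode n C) = circ_len (size C) n.
Proof.
rewrite circ_encodeE size_cat size_nseq /= !size_cat size_bits size_nseq /=.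
rewrite size_flatten /shape -map_comp.
set B := maxn _ _.
have -> D : sumn (map (size \o gate_code (clog2 n) (clog2 (size C)) B) D) = (size D * B.+2)%N.
  by elim: D => //= g D ->; rewrite size_gate_code ?leq_maxl ?leq_maxr // mulSn.
by rewrite /circ_len -/B; lia.
Qed.

(** Equal code lengths give equal sizes; then the headers coincide and the gate blocks decode one by
    one. *)
Lemma circ_encode_inj n C C' :
  circuit_wf n C -> circuit_wf n C' -> circ_encode n C = circ_encode n C' -> C = C'.
Proof.
move=> /circuit_wf_bounded wC /circuit_wf_bounded wC' E.
have sE : size C = size C'.
  have := congr1 size E; rewrite !size_circ_encode => L.
  by case: (ltngtP (size C) (size C')) => // /(circ_len_ltn n); rewrite L ltnn.
move: E; rewrite !circ_encodeE -sE => /eqP.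
rewrite eqseq_cat // eqxx eqseq_cons /= eqseq_cat // eqxx /= eqseq_cat // eqxx /=.
rewrite eqseq_cons => /andP[_ /eqP].
apply: (@flatten_map_inj _ _ _ (maxn (2 * clog2 (size C)) (clog2 n)).+2
         (gate_bounded n (size C))) => // [g|g g' gb gb'|].
- by rewrite size_gate_code ?leq_maxl ?leq_maxr.
- exact: gate_code_inj (up_logP _ _) (up_logP _ _) gb gb'.
- by rewrite sE.
Qed.

(** * Outputs of the circuit interpreter *)

Lemma circ_interpP h x : circ_spec h x (circ_interp h x).
Proof.
apply: epsilon_spec.
case: (classic (exists C, circuit_wf (size x) C /\ circ_encode (size x) C = h)).
  by move=> [C [wC hC]]; exists (Some (ceval C x)); left; exists C.
by exists None; right.
Qed.

(* [circ_spec] fixes the output of a program only because [circ_encode] is injective. *)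
Lemma circ_interp_encode n (x : n.-tuple bool) C :
  circuit_wf n C -> circ_interp (circ_encode n C) x = Some (ceval C x).
Proof.
have := circ_interpP (circ_encode n C) x; rewrite /circ_spec size_tuple.
case=> [[C' [wC' [/circ_encode_inj CC' ->]]] wC|[nC _] wC]; first by rewrite CC'.
by case: nC; exists C.
Qed.

Lemma circ_interp_defined n (x : n.-tuple bool) h :
  circ_interp h x <> None -> exists C, circuit_wf n C /\ circ_encode n C = h.
Proof.
have := circ_interpP h x; rewrite /circ_spec size_tuple.
by case=> [[C [wC [hC _]]] _|[_ ->] //]; exists C.
Qed.

(** * Circuits for the OR of chosen inputs *)

(* Even vertices accumulate: vertex 2j computes the OR of inputs idx 0, ..., idx j,
   and vertex 2j-1 is the input idx j. *)
Definition or_circuit (k : nat) (idx : nat -> nat) : circuit :=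
  mkseq (fun v => if odd v then GIn (idx v./2.+1)
                  else if v is v'.+2 then GOr v' v'.+1 else GIn (idx 0%N)) k.*2.+1.

Lemma cedge_or_circuit k idx u v :
  cedge (or_circuit k idx) u v =
  [&& (v < k.*2.+1)%N, ~~ odd v, (1 < v)%N & (u == v.-2) || (u == v.-1)].
Proof.
rewrite /cedge size_mkseq; case: ltnP => //= vk; rewrite nth_mkseq //.
case: v vk => [|[|v]] //= _; rewrite negbK.
by case: (odd v) => //=; rewrite !inE.
Qed.

Lemma sinks_or_circuit k idx : sinks (or_circuit k idx) = [:: k.*2].
Proof.
rewrite /sinks size_mkseq; set no_child := (X in seq.filter X _).
rewrite -addn1 iotaD filter_cat add0n.
have -> : seq.filter no_child (iota 0 k.*2) = [::].
  rewrite (@eq_in_filter _ _ pred0) ?filter_pred0 // => v.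
  rewrite mem_iota /= add0n => vk; apply/negbTE; rewrite negbK.
  (* An odd vertex feeds the OR just after it, an even one the OR two places further. *)
  apply/hasP; exists (if odd v then v.+1 else v.+2).
    by rewrite mem_iota; case: ifP; lia.
  by rewrite cedge_or_circuit; case: ifP => vo /=; rewrite ?vo eqxx ?orbT /= andbT; lia.
rewrite /=; have -> // : no_child k.*2.
apply/hasPn => w; rewrite mem_iota cedge_or_circuit add0n => wk.
by apply/negP => /and4P[_ _ w1 /orP[] /eqP]; lia.
Qed.

Lemma or_circuit_wf n k idx :
  (forall i, (i <= k)%N -> (idx i < n)%N) -> circuit_wf n (or_circuit k idx).
Proof.
move=> idxn; split; rewrite ?sinks_or_circuit ?size_mkseq //.
- rewrite all_map; apply/allP => v; rewrite mem_iota add0n => /= vk.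
  by case: ifP => vo; [|case: v vk vo => [|[|v]] //= vk vo]; apply: idxn; lia.
- rewrite all_map; apply/allP => v; rewrite mem_iota add0n => /= vk.
  by case: ifP => // vo; case: v vk vo => [|[|v]] //= vk vo; lia.
move=> v [|w p] // vp lp.
(* Edges increase vertex numbers, so no path returns to its start. *)
have /(order_path_min ltn_trans)/allP : path ltn v (w :: p).
  apply: sub_path vp => a b; rewrite cedge_or_circuit => /and4P[_ _ b1].
  by case/orP => /eqP ->; lia.
by have := mem_last w p; rewrite (lp : last w p = v) => vp' /(_ v vp'); rewrite /= ltnn.
Qed.

Lemma ceval_or_circuit k idx x :
  ceval (or_circuit k idx) x = has (fun i => nth false x (idx i)) (iota 0 k.+1).
Proof.
rewrite /ceval sinks_or_circuit size_mkseq [head _ _]/=.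
have := fun v => @nth_mkseq _ (GIn 0) (fun v => if odd v then GIn (idx v./2.+1)
  else if v is v'.+2 then GOr v' v'.+1 else GIn (idx 0%N)) k.*2.+1 v.
(* Abstracting the circuit keeps only its vertex equations, so simplification cannot unfold it. *)
rewrite -/(or_circuit k idx); move: (or_circuit k idx) => C nthC.
pose F j := has (fun i => nth false x (idx i)) (iota 0 j.+1); rewrite -/(F k).
have FS j : F j.+1 = F j || nth false x (idx j.+1).
  by rewrite /F -[j.+2]addn1 iotaD has_cat [X in _ || X]orbF.
suff ev j fuel : (j <= k)%N -> (j.*2 < fuel)%N -> veval C x fuel j.*2 = Some (F j).
  by rewrite ev.
elim: j fuel => [|j IHj] [|fuel] // jk jf; first by rewrite /= nthC //= /F /= orbF.
rewrite FS /= nthC; last by lia.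
rewrite /= odd_double /= IHj; [|lia|lia].
case: fuel jf => [|fuel] jf; first by lia.
rewrite /= nthC; last by lia.
by rewrite /= odd_double /= uphalf_double.
Qed.

(** * Probabilities over i.i.d. samples *)

Lemma prob_sample_all n m (P : n.-tuple bool -> R) (Q : pred (n.-tuple bool)) :
  prob_sample P (fun xs : m.-tuple (n.-tuple bool) => all Q xs) =
  (\sum_(x | Q x) P x) ^+ m.
Proof.
have -> : (\sum_(x | Q x) P x) ^+ m = \prod_(i < m) \sum_x (if Q x then P x else 0).
  by rewrite -big_mkcond prodr_const card_ord.
(* Expanding the product of sums gives a sum over functions on ['I_m], which is then reindexed by
   tuples. *)
rewrite bigA_distr_bigA /=.
rewrite (reindex (fun xs : m.-tuple (n.-tuple bool) => [ffun i => tnth xs i])) /=; last first.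
  exists (fun f : {ffun 'I_m -> n.-tuple bool} => [tuple f i | i < m]) => [xs _|f _].
    by apply: eq_from_tnth => i; rewrite tnth_mktuple ffunE.
  by apply/ffunP => i; rewrite ffunE tnth_mktuple.
apply: eq_bigr => xs _.
case: all_tnthP => [allQ|nQ].
  by rewrite mulr1; apply: eq_bigr => i _; rewrite ffunE allQ.
have [i nQi] : exists i, ~~ Q (tnth xs i).
  by apply/existsP; rewrite -negb_forall; apply/negP => /forallP.
by rewrite mulr0 (bigD1 i) //= ffunE (negbTE nQi) mul0r.
Qed.

Lemma prob_sampleC n m (P : n.-tuple bool -> R) (E : m.-tuple (n.-tuple bool) -> bool) :
  is_distr P -> prob_sample P E = 1 - prob_sample P (fun xs => ~~ E xs).
Proof.
case=> _ P1; have := prob_sample_all n m P predT; rewrite P1 expr1n => <-.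
rewrite /prob_sample -sumrB; apply: eq_bigr => xs _.
by rewrite all_predT; case: (E xs); rewrite /= ?mulr0 ?subr0 ?subrr.
Qed.

(** The events are indexed by strings grouped by length, since the strings of one length form a
    finite type. *)
Lemma prob_sample_union n m (P : n.-tuple bool -> R)
    (E : m.-tuple (n.-tuple bool) -> bool) k
    (F : forall i, i.-tuple bool -> m.-tuple (n.-tuple bool) -> bool) :
  is_distr P ->
  (forall xs, E xs -> exists (i : 'I_k) (t : i.-tuple bool), F i t xs) ->
  prob_sample P E <= \sum_(i < k) \sum_(t : i.-tuple bool) prob_sample P (F i t).
Proof.
move=> [P0 _] EF.
under eq_bigr => i _ do rewrite exchange_big /=.
rewrite exchange_big /=; apply: ler_sum => xs _.
under eq_bigr => i _ do rewrite -mulr_sumr.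
rewrite -mulr_sumr; apply: ler_wpM2l; first exact: prodr_ge0.
case Exs: (E xs); last by apply: sumr_ge0 => i _; apply: sumr_ge0.
have [i [t Ft]] := EF xs Exs.
rewrite (bigD1 i) //= (bigD1 t) //= Ft -addrA lerDl.
by apply: addr_ge0; apply: sumr_ge0 => j _ //; apply: sumr_ge0.
Qed.

(** * Occam bound for MDL *)

(** A program of accuracy below [1 - eps] fits [m] samples with probability at most
    [(1 - eps) ^+ m]. MDL outputs a program no longer than [h], and the sum of powers of 2 counts
    these. *)
Lemma occam_mdl_pac (phi : interpreter) (sel : selector) (eps delta : R) n
    (f : n.-tuple bool -> bool) (P : n.-tuple bool -> R) h m :
  mdl_selector phi sel -> is_distr P -> prog_computes phi h f -> 0 <= eps <= 1 ->
  (\sum_(i < (size h).+1) 2 ^ i)%N%:R * (1 - eps) ^+ m <= delta ->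
  mdl_pac phi sel eps delta f P m.
Proof.
move=> mdl dP hf /andP[eps0 eps1] small m' mm'.
have [P0 P1] := dP.
rewrite prob_sampleC // lerB //; apply: le_trans small.
(* Accuracy does not depend on the sample; placing it inside the event makes accurate programs
   contribute 0 to the union bound. *)
pose bad_fit i (t : i.-tuple bool) (xs : m'.-tuple (n.-tuple bool)) :=
  (accuracy P f (fun x => phi t x) < 1 - eps) &&
  all (fun x : n.-tuple bool => phi t x == Some (f x)) xs.
apply: (le_trans (prob_sample_union _ _ _ _ (size h).+1 bad_fit dP _)).
  move=> xs; rewrite -ltNge => bad.
  have cand_h : mdl_candidate phi (labelled f xs) h.
    by split=> [p /mapP[x _ ->]|x]; rewrite hf.
  have [[fit _] short] := mdl n (labelled f xs) (ex_intro _ h cand_h).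
  have lt_sz : (size (sel n (labelled f xs)) < (size h).+1)%N by rewrite ltnS short.
  exists (Ordinal lt_sz), (in_tuple (sel n (labelled f xs))).
  rewrite /bad_fit bad /=; apply/allP => x xxs; apply/eqP.
  by rewrite (fit (x, f x)) //; apply/mapP; exists x.
rewrite natr_sum mulr_suml; apply: ler_sum => i _.
have -> : (2 ^ i)%N = #|{: i.-tuple bool}| by rewrite card_tuple card_bool.
rewrite -sum1_card natr_sum mulr_suml; apply: ler_sum => t _; rewrite mul1r.
have [acc_lt|acc_ge] := ltP (accuracy P f (fun x => phi t x)) (1 - eps); last first.
  rewrite /prob_sample big1 ?exprn_ge0 ?subr_ge0 // => xs _.
  by rewrite /bad_fit ltNge acc_ge mulr0.
have -> : prob_sample P (bad_fit i t) = accuracy P f (fun x => phi t x) ^+ m'.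
  by rewrite /accuracy -prob_sample_all; apply: eq_bigr => xs _; rewrite /bad_fit acc_lt.
have acc0 : 0 <= accuracy P f (fun x => phi t x) by apply: sumr_ge0.
apply: (le_trans (lerXn2r m' _ _ (ltW acc_lt))); rewrite ?nnegrE ?subr_ge0 //.
by apply: ler_wiXn2l; rewrite ?subr_ge0 ?gerBl.
Qed.

Lemma exists_expr_le (C q delta : R) :
  0 <= C -> 0 <= q < 1 -> 0 < delta -> exists m, C * q ^+ m <= delta.
Proof.
move=> C0 /andP[q0 q1] d0.
(* Dividing by [C + 1] covers the case [C = 0]. *)
have C1 : 0 < C + 1 by lra.
case: (pow_lt_1_zero q _ (delta / (C + 1)) _) => [||m qm].
- by apply/RltP; rewrite RabsE ger0_norm.
- by apply/RltP; apply: divr_gt0.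
exists m; move: (qm m (Nat.le_refl m)) => /RltP.
rewrite RabsE RpowE ger0_norm ?exprn_ge0 // ltr_pdivlMr // => qmC.
by apply: le_trans (ltW qmC); rewrite mulrDr mulr1 mulrC lerDl exprn_ge0.
Qed.

(** * Existence of the sample complexity *)

Lemma sample_complexityP phi sel eps delta n (f : n.-tuple bool -> bool) P :
  is_sample_complexity phi sel eps delta f P (sample_complexity phi sel eps delta f P).
Proof.
apply: epsilon_spec.
case: (classic (exists m, (0 < m)%N /\ mdl_pac phi sel eps delta f P m)); last first.
  by move=> none; exists None => m m0 pac; apply: none; exists m.
case=> m; elim/ltn_ind: m => m IHm [m0 pac].
case: (classic (exists m', [/\ (m' < m)%N, (0 < m')%N & mdl_pac phi sel eps delta f P m'])).
  by case=> m' [/IHm IH m'0 pac']; apply: IH.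
move=> least; exists (Some m); split=> // m' m'0 pac'.
by rewrite leqNgt; apply/negP => m'm; apply: least; exists m'.
Qed.

(** * The hard distribution for circuits *)

Definition zero_vec n : n.-tuple bool := [tuple of nseq n false].

Definition unit_vec n (i : 'I_n) : n.-tuple bool := [tuple j == i | j < n].

(** Indicators let the mass of an event collapse to its values at the zero vector and the unit
    vectors. *)
Definition or_distr n (x : n.-tuple bool) : R :=
  2^-1 * (x == zero_vec n)%:R + \sum_(i < n) (2 * n%:R)^-1 * (x == unit_vec n i)%:R.

Lemma nth_zero_vec n j : nth false (zero_vec n) j = false.
Proof. by rewrite nth_nseq if_same. Qed.

Lemma nth_unit_vec n (i : 'I_n) j : nth false (unit_vec n i) j = (j == i).
Proof.
have [jn|nj] := ltnP j n.
  by rewrite -[j]/(val (Ordinal jn)) -tnth_nth tnth_mktuple.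
by rewrite nth_default ?size_tuple //; apply/esym/negbTE; rewrite neq_ltn (leq_trans _ nj) ?orbT.
Qed.

Lemma has_zero_vec n : has id (zero_vec n) = false.
Proof. by rewrite has_nseq andbF. Qed.

Lemma has_unit_vec n (i : 'I_n) : has id (unit_vec n i).
Proof. by apply/(has_nthP false); exists i; rewrite ?size_tuple // nth_unit_vec eqxx. Qed.

Lemma sum_point (T : finType) (Q : pred T) (a : R) (z : T) :
  \sum_(x | Q x) a * (x == z)%:R = a * (Q z)%:R.
Proof.
rewrite -mulr_sumr; congr (_ * _); rewrite big_mkcond (bigD1 z) //= eqxx big1 ?addr0.
  by case: (Q z).
by move=> x /negbTE ->; rewrite if_same.
Qed.

Lemma sum_or_distr n (Q : pred (n.-tuple bool)) :
  \sum_(x | Q x) or_distr n x =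
  2^-1 * (Q (zero_vec n))%:R + \sum_(i < n) (2 * n%:R)^-1 * (Q (unit_vec n i))%:R.
Proof.
rewrite big_split /= sum_point exchange_big /=; congr (_ + _).
by apply: eq_bigr => i _; rewrite sum_point.
Qed.

Lemma or_distr_is_distr n : (0 < n)%N -> is_distr (or_distr n).
Proof.
move=> n0; have n0' : 0 < n%:R :> R by rewrite ltr0n.
split=> [x|].
  by apply: addr_ge0; [|apply: sumr_ge0 => i _]; rewrite mulr_ge0 // ?invr_ge0 ?mulr_ge0.
rewrite (sum_or_distr n predT) /= sumr_const card_ord -mulr_natr; field.
by rewrite lt0r_neq0.
Qed.

(** * Inaccuracy of small circuits *)

Lemma circuit_or_accuracy n C eps (hyp : n.-tuple bool -> option bool) :
  (forall x : n.-tuple bool, hyp x = Some (ceval C x)) -> eps < 1 / 2 ->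
  (size C).+1%:R < (1 - 2 * eps) * n%:R ->
  accuracy (or_distr n) (fun x => has id x) hyp < 1 - eps.
Proof.
move=> hypC eps_half fewC.
have n0 : 0 < n%:R :> R.
  rewrite lt_neqAle ler0n andbT eq_sym; apply/negP => /eqP n0.
  by move: fewC; rewrite n0 mulr0 ltNge ler0n.
rewrite /accuracy sum_or_distr has_zero_vec hypC.
under eq_bigr => i _ do rewrite has_unit_vec hypC.
(* With output 1 on the zero vector, only the mass 1/2 of the unit vectors can be right. *)
case Cz: (ceval C (zero_vec n)) => /=.
  rewrite mulr0 add0r (le_lt_trans (y := \sum_(i < n) (2 * n%:R)^-1)) //.
    by apply: ler_sum => i _; rewrite ler_piMr ?invr_ge0 ?mulr_ge0 ?ler0n // lern1 leq_b1.
  have -> : \sum_(i < n) (2 * n%:R)^-1 = 2^-1 :> R.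
    by rewrite sumr_const card_ord -mulr_natr; field; rewrite lt0r_neq0.
  by lra.
(* With output 0 there, at most one unit vector per entry of [circuit_reads] is right, each of mass
   1/(2n); [fewC] bounds the total. *)
rewrite mulr1 (le_lt_trans (y := 2^-1 + (2 * n%:R)^-1 * (size C).+1%:R)) //; last first.
  by rewrite -ltrBrDl mulrC ltr_pdivrMr ?mulr_gt0 //; lra.
rewrite lerD2l -mulr_sumr ler_wpM2l ?invr_ge0 ?mulr_ge0 ?ler0n //.
rewrite -natr_sum ler_nat.
have -> : (\sum_(i < n) (ceval C (unit_vec n i) == true) =
           #|[pred i : 'I_n | ceval C (unit_vec n i)]|)%N.
  rewrite -sum1_card [RHS]big_mkcond /=; apply: eq_bigr => i _.
  by rewrite inE; case: (ceval _ _).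
rewrite cardE -(size_map val).
have -> : (size C).+1 = size (circuit_reads C) by rewrite /= size_map.
apply: uniq_leq_size; first by rewrite map_inj_uniq ?enum_uniq //; exact: val_inj.
move=> v /mapP[i]; rewrite mem_enum inE => Ci ->.
(* On the unit vector of an unread coordinate the circuit behaves as on the zero vector. *)
apply: contraTT Ci => unread.
rewrite (ceval_reads C (unit_vec n i) (zero_vec n)) ?Cz // => j jr.
rewrite nth_zero_vec nth_unit_vec; apply/eqP => ji.
by move: unread; rewrite -[val i]/(nat_of_ord i) -ji jr.
Qed.

(** * MDL with circuits *)

Lemma mdl_circ_output (sel : selector) n m (xs : m.-tuple (n.-tuple bool)) :
  mdl_selector circ_interp sel -> (0 < n)%N ->
  exists2 C : circuit, (size C <= m.*2.+1)%N &
    forall x : n.-tuple bool,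
      circ_interp (sel n (labelled (fun x => has id x) xs)) x = Some (ceval C x).
Proof.
move=> mdl n0; set D := labelled _ xs.
(* The first 1 of [x]. The value 0 for the zero vector is harmless, as a 1 on any input makes OR
   true. *)
pose pos (x : n.-tuple bool) := if has id x then find id x else 0%N.
have pos_ltn x : (pos x < n)%N.
  by rewrite /pos; case: ifP => //; rewrite has_find size_tuple.
(* The circuit reads [idx 0] to [idx m], one more than the samples; the default makes the last one
   input 0. *)
pose idx := nth 0%N (map pos xs).
pose C0 := or_circuit m idx.
have wC0 : circuit_wf n C0.
  apply: or_circuit_wf => i _; rewrite /idx.
  have [im|mi] := ltnP i m.
    by rewrite (nth_map (zero_vec n)) ?size_tuple.
  by rewrite nth_default // size_map size_tuple.
have cand : mdl_candidate circ_interp D (circ_encode n C0).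
  split=> [p /mapP[x xxs ->]|x]; rewrite circ_interp_encode //=.
  (* Any 1 that is read proves OR true; conversely a sampled nonzero [x] has its own first 1 among
     the inputs read. *)
  rewrite ceval_or_circuit; congr Some; apply/hasP/idP => [[i _ xi]|hx].
    apply/(has_nthP false); exists (idx i); rewrite // ltnNge.
    by apply: contraTN xi => /(nth_default false) ->.
  exists (index x xs); first by rewrite mem_iota ltnS (leq_trans (index_size x xs)) ?size_tuple.
  by rewrite /idx (nth_map x) ?index_mem // nth_index // /pos hx; exact: (nth_find false hx).
have [[_ total] short] := mdl n D (ex_intro _ _ cand).
have [C [wC hC]] := circ_interp_defined _ _ _ (total (zero_vec n)).
exists C => [|x]; last by rewrite -hC circ_interp_encode.
have := short _ cand; rewrite -hC !size_circ_encode.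
rewrite [size C0]size_mkseq; apply: contraTT; rewrite -!ltnNge; exact: circ_len_ltn.
Qed.

Lemma circ_pac_lower_bound (sel : selector) eps delta n m :
  mdl_selector circ_interp sel -> (0 < n)%N -> (0 < m)%N -> eps < 1 / 2 -> delta < 1 ->
  mdl_pac circ_interp sel eps delta (fun x : n.-tuple bool => has id x) (or_distr n) m ->
  (1 - 2 * eps) * n%:R <= 4 * m%:R.
Proof.
move=> mdl n0 m0 eps_half delta1 /(_ m (leqnn m)); apply: contraTT; rewrite -!ltNge => few.
(* Every sample yields an inaccurate hypothesis, so the success probability is 0, less than
   [1 - delta]. *)
rewrite /prob_sample big1 ?subr_gt0 // => xs _.
have [C sC hC] := mdl_circ_output sel n m xs mdl n0.
rewrite leNgt (circuit_or_accuracy n C) ?mulr0 //.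
(* Here [(size C).+1 <= 2m+2 <= 4m], since [m > 0]. *)
apply: le_lt_trans few; rewrite -natrM ler_nat; lia.
Qed.

(** * Linear lower bound on the gain *)

Theorem theorem4 :
  forall (eps delta : R) (c d : nat) (gamma : R),
    0 < eps < 1 / 2 -> 0 < delta < 1 -> (0 < d)%N -> (1 < c)%N -> 0 < gamma ->
  forall (U : interpreter), time_bounded_universal c U ->
  forall (selU selC : selector),
    mdl_selector U selU -> mdl_selector circ_interp selC ->
  exists K : R, 0 < K /\ exists N : nat, forall n : nat, (N <= n)%N ->
    ((K * Rpower (INR n) (1 - gamma))%:E <= gain U selU circ_interp selC d eps delta n)%E.
Proof.
move=> eps delta c d gamma /andP[eps0 eps_half] /andP[delta0 delta1] d0 c1 gamma0 U.
move=> [E [_ [_ [_ simulates]]]] selU selC mdlU mdlC.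
(* The time exponent 1 of [or_tm] is below [c]. *)
have [|h [N0 hN]] := simulates 1 (has id) or_tm _ or_tm_linear_time.
  by rewrite INRE ltr1n.
pose q := 1 - eps.
have [||A smallA] := exists_expr_le (\sum_(i < (size h).+1) 2 ^ i)%N%:R q delta _ _ delta0.
- exact: ler0n.
- by apply/andP; split; rewrite /q; lra.
(* The circuit lower bound [(1 - 2 * eps) * n / 4] divided by the bound [A.+1] for [U], up to the
   factor [n]. *)
exists ((1 - 2 * eps) / (4 * A.+1%:R)); split.
  by rewrite divr_gt0 ?mulr_gt0 ?ltr0n //; lra.
(* [N0] makes [h] correct on length [n], and [size h < n] gives [size h <= n ^ d]. *)
exists (maxn N0 (size h).+1) => n; rewrite geq_max => /andP[N0n hn].
have n0 : (0 < n)%N by exact: leq_ltn_trans hn.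
pose f (x : n.-tuple bool) := has id x.
have hf : prog_computes U h f by move=> x; rewrite hN ?size_tuple.
(* [A] may be 0, while a sample complexity is positive, hence [A.+1]. *)
have pacU : mdl_pac U selU eps delta f (or_distr n) A.+1.
  have pacA : mdl_pac U selU eps delta f (or_distr n) A.
    apply: (occam_mdl_pac _ _ _ _ _ _ _ h) => //; first exact: or_distr_is_distr.
    by apply/andP; split; lra.
  by move=> m /ltnW; exact: pacA.
apply: (@le_trans _ _ (sc_ratio (sample_complexity circ_interp selC eps delta f (or_distr n))
                                (sample_complexity U selU eps delta f (or_distr n)))); last first.
  apply: ereal_sup_ubound; exists f, (or_distr n); split=> //; first exact: or_distr_is_distr.
  by exists h; split=> //; rewrite (leq_trans (ltnW hn)) // -{1}(expn1 n) leq_pexp2l.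
have := sample_complexityP U selU eps delta n f (or_distr n).
case: (sample_complexity U _ _ _ _ _) => [a|] /=; last by move=> /(_ A.+1 erefl).
move=> [a0 _ /(_ A.+1 erefl pacU) aA].
have := sample_complexityP circ_interp selC eps delta n f (or_distr n).
(* An infinite circuit sample complexity makes the ratio [+oo]. *)
case: (sample_complexity circ_interp _ _ _ _ _) => [b|] /=; last by rewrite leey.
move=> [b0 pacb _]; rewrite lee_fin.
have lb := circ_pac_lower_bound _ _ _ _ _ mdlC n0 b0 eps_half delta1 pacb.
(* The ratio is linear in [n], and [gamma > 0] gives the weaker power. *)
have npow : Rpower (INR n) (1 - gamma) <= n%:R.
  have n1 : Rle 1 (INR n) by apply/RleP; rewrite INRE ler1n.
  have g1 : Rle (1 - gamma) 1 by apply/RleP; rewrite gerBl ltW.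
  have /RleP := Rle_Rpower _ _ _ n1 g1; rewrite Rpower_1 ?INRE //.
  by apply/RltP; rewrite ltr0n.
apply: (@le_trans _ _ ((1 - 2 * eps) / (4 * A.+1%:R) * n%:R)).
  by rewrite ler_wpM2l // divr_ge0 ?mulr_ge0 ?ler0n //; lra.
rewrite mulrAC ler_pdivrMr ?mulr_gt0 ?ltr0n // (le_trans lb) //.
rewrite mulrCA ler_wpM2l // mulrAC ler_pdivlMr ?ltr0n //.
by rewrite ler_wpM2l ?ler0n // ler_nat.
Qed.
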